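(* Let $K$ be an algebraically closed field and let $A$ be a finite-dimensional commutative associative $K$-algebra with unit. Then $A$ has a Frobenius filtration.
   Context: A metric on a $K$-vector space is a nondegenerate symmetric $K$-bilinear form. A nondegenerate filtration on a finite-dimensional $K$-vector space $V$ is a pair $(I_\bullet,g_\bullet)$ consisting of an exhaustive increasing filtration $I_\bullet=(I_k)_{k\in\mathbb{Z}}$ of $V$ by subspaces (so $I_{k-1}\subset I_k$ for all $k$, $I_k=V$ for $k\gg 0$, and $I_k=0$ for $k\ll 0$) and a metric $g_k$ on $I_k/I_{k-1}$ for each $k\in\mathbb{Z}$. For an algebra $B$ and a $B$-module $I$, a metric $g$ on $I$ is called $B$-invariant if $g(b\cdot x,y)=g(x,b\cdot y)$ for all $b\in B$, $x,y\in I$. A Frobenius filtration on a $K$-algebra $A$ is a nondegenerate filtration $(I_\bullet,g_\bullet)$ on $A$ such that each $I_k$ is an ideal of $A$ and each metric $g_k$ on $I_k/I_{k-1}$ is $A/I_{k-1}$-invariant. *)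

(* Defs.v *)
From HB Require Import structures.
From mathcomp Require Import all_boot all_order all_algebra.

Set Implicit Arguments.
Unset Strict Implicit.
Unset Printing Implicit Defensive.

Import GRing.Theory.
Local Open Scope ring_scope.
Local Open Scope quotient_scope.

(* Finite-dimensional commutative associative unital algebras. In ssralg,
   algebras (hence also falgType) are nonzero rings, so they exclude the zero
   algebra, which is allowed here. *)
HB.mixin Record Vector_isComAlg (K : fieldType) A of Vector K A := {
  alg_mul : A -> A -> A;
  alg_one : A;
  alg_mulA : associative alg_mul;
  alg_mulC : commutative alg_mul;
  alg_mul1 : left_id alg_one alg_mul;
  alg_mulDl : left_distributive alg_mul +%R;
  alg_scaleAl : forall (a : K) (u v : A),
    a *: alg_mul u v = alg_mul (a *: u) v
}.

#[short(type="comVectAlgType")]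
HB.structure Definition ComVectAlg (K : fieldType) :=
  {A of Vector_isComAlg K A & Vector K A}.

HB.instance Definition _ (K : fieldType) (A : comVectAlgType K) :=
  GRing.Zmodule_isComPzRing.Build (ComVectAlg.sort A)
    alg_mulA alg_mulC alg_mul1 alg_mulDl.

Lemma vscalerAl (K : fieldType) (A : comVectAlgType K) (a : K) (u v : A) :
  a *: (u * v) = (a *: u) * v.
Proof. exact: alg_scaleAl. Qed.

Definition vquot (K : fieldType) (V : vectType K) (W : {vspace V}) : Type :=
  {ideal_quot pred_of_vspace W}.

Section VectorQuotient.
Import VectorInternalTheory.
Variables (K : fieldType) (V : vectType K) (W : {vspace V}).

HB.instance Definition _ :=
  ZmodQuotient.on (vquot W).
HB.instance Definition _ := GRing.Zmodule.on (vquot W).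

Lemma vquot_eqP (x y : V) :
  reflect (\pi_(vquot W) x = \pi_(vquot W) y) (x - y \in W).
Proof. by rewrite Quotient.idealrBE; exact: eqP. Qed.

Definition vquot_scale (a : K) := lift_op1 (vquot W) ( *:%R a).

Lemma pi_vquot_scale a x :
  vquot_scale a (\pi_(vquot W) x) = \pi_(vquot W) (a *: x).
Proof.
rewrite /vquot_scale -lock; apply/vquot_eqP; rewrite -scalerBr; apply: rpredZ.
by apply/vquot_eqP; rewrite reprK.
Qed.

Fact vquot_scaleA a b x :
  vquot_scale a (vquot_scale b x) = vquot_scale (a * b) x.
Proof. by elim/quotW: x => x; rewrite !pi_vquot_scale scalerA. Qed.

Fact vquot_scale1 : left_id 1 vquot_scale.
Proof. by elim/quotW=> x; rewrite pi_vquot_scale scale1r. Qed.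

Fact vquot_scaleDr : right_distributive vquot_scale +%R.
Proof.
move=> a; elim/quotW=> x; elim/quotW=> y.
by rewrite -raddfD !pi_vquot_scale scalerDr raddfD.
Qed.

Fact vquot_scaleDl x : {morph vquot_scale^~ x : a b / a + b}.
Proof.
by elim/quotW: x => x a b; rewrite !pi_vquot_scale scalerDl raddfD.
Qed.

HB.instance Definition _ := GRing.Zmodule_isLmodule.Build K (vquot W)
  vquot_scaleA vquot_scale1 vquot_scaleDr vquot_scaleDl.

Fact pi_vquot_scalable : scalable \pi_(vquot W).
Proof. by move=> a x; rewrite -pi_vquot_scale. Qed.
HB.instance Definition _ :=
  GRing.isScalable.Build K V (vquot W) *:%R \pi_(vquot W) pi_vquot_scalable.

Fact vquot_vect_iso : Vector.axiom (dim (subvs_of (W^C)%VS)) (vquot W).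
Proof.
pose p : 'End(V) := daddv_pi (W^C)%VS W.
have dW : ((W^C)%VS :&: W = 0)%VS by rewrite capvC capv_compl.
have p0 x : x \in W -> p x = 0.
  move=> Wx; have := daddv_pi_add dW (_ : x \in (W^C + W)%VS).
  rewrite addvC addv_complf memvf => /(_ isT).
  rewrite (@daddv_pi_id _ _ W) // 1?capvC // -[RHS]add0r.
  by move=> /addIr.
have pE x : p (repr (\pi_(vquot W) x)) = p x.
  apply/eqP; rewrite -subr_eq0 -linearB /=; apply/eqP/p0.
  by apply/vquot_eqP; rewrite reprK.
exists (fun x => v2r (vsproj (W^C)%VS (p (repr x)))).
  move=> a; elim/quotW=> x; elim/quotW=> y.
  by rewrite -[a *: _]linearZ -raddfD /= !pE !linearP.
exists (fun r => \pi_(vquot W) (vsval (r2v r : subvs_of (W^C)%VS))).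
  elim/quotW=> x; rewrite pE v2rK vsprojK ?memv_pi //.
  apply/esym/vquot_eqP.
  have := daddv_pi_add dW (_ : x \in (W^C + W)%VS).
  rewrite addvC addv_complf memvf => /(_ isT) {1}<-.
  by rewrite addrAC subrr add0r memv_pi.
move=> r; rewrite pE; apply: (canLR r2vK); rewrite /p daddv_pi_id ?subvsP //.
exact: vsvalK.
Qed.

HB.instance Definition _ := Lmodule_hasFinDim.Build K (vquot W) vquot_vect_iso.

End VectorQuotient.

(* U / W when W <= U; in general U / (U :&: W). *)
Definition subquot (K : fieldType) (V : vectType K) (U W : {vspace V}) :=
  vquot (linfun (vsval : subvs_of U -> V) @^-1: W)%VS.

Record metric (K : fieldType) (V : vectType K) := Metric {
  metric_form :> {symmetric V};
  metric_nondegenerate : nondegenerate metric_form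
}.

Record nondegenerate_filtration (K : fieldType) (V : vectType K) := {
  filt_space :> int -> {vspace V};
  filt_increasing : forall k : int, (filt_space (k - 1) <= filt_space k)%VS;
  filt_exhaustive :
    exists N : int, forall k : int, N <= k -> filt_space k = fullv;
  filt_bounded_below :
    exists N : int, forall k : int, k <= N -> filt_space k = 0%VS;
  filt_metric : forall k : int,
    metric (subquot (filt_space k) (filt_space (k - 1)))
}.

Definition invariant_form (R B M : Type) (act : B -> M -> M)
    (g : M -> M -> R) : Prop :=
  forall (b : B) (x y : M), g (act b x) y = g x (act b y).

Section Ideals.
Variables (K : fieldType) (A : comVectAlgType K).

Definition is_ideal (I : {vspace A}) : Prop :=
  forall a x : A, x \in I -> a * x \in I.

(* The action of A / J on I / J; it is independent of the choice of
   representatives when I and J are ideals, see quot_actE. *)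
Definition quot_act (I J : {vspace A}) (b : vquot J) (x : subquot I J) :
    subquot I J :=
  \pi_(subquot I J) (vsproj I (repr b * vsval (repr x))).

Lemma quot_actE (I J : {vspace A}) (a : A) (x : subvs_of I) :
    is_ideal I -> is_ideal J ->
  quot_act (\pi_(vquot J) a) (\pi_(subquot I J) x)
    = \pi_(subquot I J) (vsproj I (a * vsval x)).
Proof.
move=> idI idJ; apply/vquot_eqP; rewrite -memv_preim lfunE /=.
rewrite !vsprojK ?idI ?subvsP //.
set b := repr _; set y := repr _.
have Jb : b - a \in J by apply/vquot_eqP; rewrite reprK.
have Jy : vsval y - vsval x \in J.
  have : y - x \in (linfun (vsval : subvs_of I -> A) @^-1: J)%VS.
    by apply/vquot_eqP; rewrite reprK.
  by rewrite -memv_preim lfunE.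
have -> : b * vsval y - a * vsval x
    = vsval y * (b - a) + a * (vsval y - vsval x).
  by rewrite !mulrBr addrA (mulrC _ b) (mulrC _ a) subrK.
by rewrite rpredD ?idJ.
Qed.

Definition is_Frobenius_filtration (F : nondegenerate_filtration A) : Prop :=
  (forall k : int, is_ideal (F k)) /\
  (forall k : int,
     invariant_form (@quot_act (F k) (F (k - 1))) (filt_metric F k)).

End Ideals.

(* Main.v *)
From HB Require Import structures.
Require Import Defs.
From mathcomp Require Import all_boot all_order all_algebra.

(* Since K is algebraically closed and A is commutative, every proper ideal J
   lies strictly below an ideal I such that every element of A acts on I / J by
   a scalar: starting from A itself, cut down successively to the eigenspace
   (modulo J) of each element of a basis of A. Iterating from J = 0 yields a
   chain of ideals exhausting A. As scalars are self-adjoint for every bilinear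
   form, any metric on the successive quotients is invariant. *)

Set Implicit Arguments.
Unset Strict Implicit.
Unset Printing Implicit Defensive.

Import GRing.Theory.
Local Open Scope ring_scope.
Local Open Scope quotient_scope.

Section DotForm.
Import VectorInternalTheory.
Variables (K : fieldType) (V : vectType K).

Definition coord_dot (x y : V) : K := \sum_i v2r x 0 i * v2r y 0 i.

Fact coord_dot_bilinear : bilinear_for
  (GRing.Scale.Law.clone _ _ *%R _) (GRing.Scale.Law.clone _ _ (idfun \; *%R) _)
  coord_dot.
Proof.
split=> z a x y; rewrite /coord_dot linearP /= mulr_sumr -big_split;
  apply: eq_bigr => i _ /=; rewrite !mxE.
  by rewrite mulrDl mulrA.
by rewrite mulrDr mulrCA.
Qed.
HB.instance Definition _ :=
  bilinear_isBilinear.Build K V V K _ _ coord_dot coord_dot_bilinear.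

Fact coord_dot_hermitian x y :
  coord_dot x y = (-1) ^+ false * idfun (coord_dot y x).
Proof. by rewrite mul1r; apply: eq_bigr => i _; rewrite mulrC. Qed.
HB.instance Definition _ := isHermitianSesquilinear.Build K V false idfun
  coord_dot coord_dot_hermitian.

(** Pairing with the [i]-th basis vector reads off the [i]-th coordinate, so a vector orthogonal to
    everything vanishes, in any characteristic. *)
Lemma coord_dot_nondegenerate : nondegenerate coord_dot.
Proof.
apply/eqP/vspaceP=> x; rewrite memv0; apply/idP/eqP=> [|->]; last exact: mem0v.
move=> /mem_orthovP xP; apply: (can_inj v2rK); rewrite linear0.
apply/rowP=> i; rewrite mxE.
have := xP (r2v (delta_mx 0 i)) (memvf _); rewrite /= /coord_dot.
rewrite (bigD1 i) //= big1 => [|j ji]; rewrite r2vK !mxE ?eqxx /=.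
  by rewrite addr0 mulr1.
by rewrite (negPf ji) mulr0.
Qed.

Definition coord_dot_metric : metric V := Metric coord_dot_nondegenerate.

End DotForm.

Section Eigenvector.
Import VectorInternalTheory.
Variable K : closedFieldType.

(** The characteristic polynomial has degree [dim V], which is positive, so it has a root in [K]. *)
Lemma exists_eigenvector (V : vectType K) (f : 'End(V)) : (0 < \dim {:V})%N ->
  exists a, exists2 x, x != 0 & f x = a *: x.
Proof.
rewrite dimvf => V_gt0.
have /closed_rootP[a] : size (char_poly (f2mx f)) != 1.
  by rewrite size_char_poly; case: (dim V) V_gt0.
rewrite -eigenvalue_root_char => /eigenvalueP[v vf v0]; exists a, (r2v v).
  by apply: contraNneq v0 => v0; rewrite -(r2vK v) v0 linear0.
by rewrite unlock /= r2vK vf linearZ.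
Qed.

(** A complement [D] of [J] in [I] stands in for [I / J]: an eigenvector of the compression of [f]
    to [D] is an eigenvector of [f] modulo [J]. *)
Lemma exists_eigenvector_mod (V : vectType K) (f : 'End(V))
    (I J : {vspace V}) :
    (J <= I)%VS -> J != I -> (f @: I <= I)%VS ->
  exists a, exists x, [/\ x \in I, x \notin J & f x - a *: x \in J].
Proof.
move=> sJI neJI fI; pose D := (I :\: J)%VS.
pose g : 'End(subvs_of D) :=
  linfun (vsproj D \o (daddv_pi D J \o f)%VF \o vsval).
have [|a [x x0]] := exists_eigenvector g.
  rewrite dimvf /dim /= lt0n dimv_eq0.
  apply: contraNneq neJI => D0; have := addv_diff I J.
  by rewrite -/D D0 add0v (addv_idPl sJI) => ->.
have Dx := subvsP x; have Ix := subvP (diffvSl I J) _ Dx.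
rewrite lfunE /= => fx; exists a, (vsval x); split=> //.
  apply: contra x0 => Jx; rewrite -(inj_eq subvs_inj) linear0 -memv0.
  by rewrite -(capv_diff I J) memv_cap Dx.
(* Split [f x] along [I = D + J]: the component in [D] is [a *: x], and the other one lies in
   [J]. *)
have /(_ _)/esym := @addv_pi1_pi2 _ _ I J (f (vsval x)).
rewrite (addv_idPl sJI) => -> //; last exact/(subvP fI)/memv_img.
have -> : addv_pi1 I J (f (vsval x)) = a *: vsval x.
  by have /= := congr1 vsval fx; rewrite comp_lfunE vsprojK ?memv_pi.
by rewrite addrAC subrr add0r memv_pi2.
Qed.

End Eigenvector.

Section Ideals.
Variables (K : fieldType) (A : comVectAlgType K).

(** Named so that multiplication by [a] can be declared linear and turned into an endomorphism by
    [linfun]. *)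
Definition mulv (a x : A) : A := a * x.

Fact mulv_linear a : linear (mulv a).
Proof.
by move=> c x y; rewrite /mulv mulrDr !(mulrC a) vscalerAl.
Qed.
HB.instance Definition _ a :=
  GRing.isLinear.Build K A A *:%R (mulv a) (mulv_linear a).

(** Phrased on representatives, so that the chain of ideals is built without quotient spaces. *)
Definition acts_by_scalar (I J : {vspace A}) (a : A) : Prop :=
  exists c : K, forall x, x \in I -> a * x - c *: x \in J.

(** The elements acting by scalars form a subspace of [A]. *)
Lemma acts_by_scalar_basis (I J : {vspace A}) :
  (forall a, a \in vbasis {:A} -> acts_by_scalar I J a) ->
  forall a, acts_by_scalar I J a.
Proof.
move=> scal a; rewrite (coord_vbasis (memvf a)).
elim/big_rec: _ => [|i b _ [d db]].
  by exists 0 => x _; rewrite mul0r scale0r subr0 mem0v.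
have [|c ce] := scal (vbasis {:A})`_i; first by rewrite mem_nth ?size_tuple.
exists (coord (vbasis {:A}) i a * c + d) => x Ix.
rewrite mulrDl -vscalerAl scalerDl -scalerA opprD addrACA -scalerBr.
by rewrite rpredD ?rpredZ ?ce ?db.
Qed.

Lemma quot_act_scalar (I J : {vspace A}) (b : vquot J) :
    is_ideal I -> (forall a, acts_by_scalar I J a) ->
  exists c : K, forall x : subquot I J, quot_act b x = c *: x.
Proof.
move=> idI /(_ (repr b))[c cP]; exists c => x.
rewrite -{2}[x]reprK -[RHS]linearZ; apply/vquot_eqP.
rewrite -memv_preim lfunE linearB linearZ /= vsprojK ?idI ?subvsP //.
by rewrite scalerN; apply/cP/subvsP.
Qed.

Lemma quot_act_invariant (I J : {vspace A}) (g : {symmetric (subquot I J)}) :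
  is_ideal I -> (forall a, acts_by_scalar I J a) ->
  invariant_form (@quot_act K A I J) g.
Proof.
move=> idI scal b x y; have [c cP] := quot_act_scalar b idI scal.
by rewrite !cP linearZl linearZr.
Qed.

Lemma is_ideal0 : is_ideal (0%VS : {vspace A}).
Proof. by move=> a x; rewrite !memv0 => /eqP->; rewrite mulr0. Qed.

(** Handles the constant stretches of the filtration, where the quotient is zero. *)
Lemma acts_by_scalar_subv (I J : {vspace A}) (a : A) :
  is_ideal I -> (I <= J)%VS -> acts_by_scalar I J a.
Proof.
move=> idI sIJ; exists 0 => x Ix.
by rewrite scale0r subr0 (subvP sIJ) ?idI.
Qed.

End Ideals.

Section FrobeniusChain.
Variables (K : closedFieldType) (A : comVectAlgType K).

Lemma exists_scalar_ideal (J : {vspace A}) (s : seq A) :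
    is_ideal J -> J != fullv ->
  exists I, [/\ is_ideal I, (J <= I)%VS, J != I &
    forall a, a \in s -> acts_by_scalar I J a].
Proof.
move=> idJ neJ; elim: s => [|a s [I [idI sJI neJI Is]]].
  by exists fullv; split=> // [b x _|]; rewrite ?memvf ?subvf.
have fI : (linfun (mulv a) @: I <= I)%VS.
  by apply/subvP=> _ /memv_imgP[x Ix ->]; rewrite lfunE idI.
have [c [x [Ix Jx xP]]] := exists_eigenvector_mod sJI neJI fI.
(* The eigenspace of [a] on [I] modulo [J]; the eigenvector [x] shows that it differs from [J]. *)
pose I' := (I :&: (linfun (mulv a) - c *: \1)%VF @^-1: J)%VS.
have I'E y : (y \in I') = (y \in I) && (a * y - c *: y \in J).
  by rewrite memv_cap -memv_preim !lfun_simp.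
exists I'; split.
(* By commutativity, [a * (b * y) - c *: (b * y) = b * (a * y - c *: y)], and [J] is an ideal. *)
- move=> b y; rewrite !I'E => /andP[Iy Jy]; rewrite idI //=.
  by rewrite mulrCA (mulrC b y) vscalerAl (mulrC _ b) -mulrBr idJ.
- by apply/subvP=> y Jy; rewrite I'E (subvP sJI) // rpredB ?rpredZ ?idJ.
- by apply: contraNneq Jx => ->; rewrite I'E Ix; move: xP; rewrite lfunE.
- move=> b; rewrite inE => /predU1P[->|sb].
    by exists c => y; rewrite I'E => /andP[].
  have [d dP] := Is b sb; exists d => y.
  by rewrite I'E => /andP[Iy _]; apply: dP.
Qed.

Lemma exists_scalar_chain (J : {vspace A}) : is_ideal J ->
  exists f : nat -> {vspace A},
    [/\ f 0 = J, forall k, is_ideal (f k), forall k, (f k <= f k.+1)%VS,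
        forall k a, acts_by_scalar (f k.+1) (f k) a
      & exists N, forall k, (N <= k)%N -> f k = fullv].
Proof.
(* Induction on the codimension of [J]: it drops for the larger ideal [I], and [J] is prepended to
   the chain that starts at [I]. *)
have [n] := ubnP (\dim {:A} - \dim J); elim: n J => // n IHn J ltn idJ.
have [->|neJ] := eqVneq J fullv.
  have idA : is_ideal (fullv : {vspace A}) by move=> a x _; exact: memvf.
  exists (fun=> fullv); split=> //; last by exists 0.
  by move=> _ a; apply: acts_by_scalar_subv.
have [I [idI sJI neJI scal]] := exists_scalar_ideal (vbasis {:A}) idJ neJ.
have [|f [f0 idf subf scalf [N fN]]] := IHn I _ idI.
  have ltJI : (\dim J < \dim I)%N.
    by rewrite ltnNge; move: neJI; rewrite eqEdim sJI.
  apply: leq_trans (ltn : (_ <= n)%N).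
  by rewrite ltn_sub2l // (leq_trans ltJI) ?dimvS ?subvf.
exists (fun k => if k is k'.+1 then f k' else J); split=> //.
- by case.
- by case=> [|k] //; rewrite f0.
- by case=> [|k] //; rewrite f0; apply: acts_by_scalar_basis.
- by exists N.+1; case.
Qed.

End FrobeniusChain.

Theorem theorem2p3 (K : closedFieldType) (A : comVectAlgType K) :
  exists F : nondegenerate_filtration A, is_Frobenius_filtration F.
Proof.
have [f [f0 idf subf scalf [N fN]]] := exists_scalar_chain (@is_ideal0 K A).
(* Since [f 0] is zero, the step from index -1 to 0 has zero quotient, like all steps below it. *)
pose F (k : int) := if k is Posz n then f n else 0%VS.
have F_step k : (F (k - 1) <= F k)%VS /\
    forall a, acts_by_scalar (F k) (F (k - 1)) a.
  (* [Negz j] denotes [-(j + 1)], so the predecessor raises [j] by one. *)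
  have negF j : (Negz j - 1)%R = Negz j.+1.
    by rewrite !NegzE -opprD -PoszD addn1.
  case: k => [[|n]|n].
  - rewrite /= f0 subvv; split=> // a.
    exact: acts_by_scalar_subv (@is_ideal0 _ _) (subvv _).
  - have -> : n.+1%:Z - 1 = n by rewrite -addn1 PoszD addrK.
    by split; [apply: subf | apply: scalf].
  - rewrite negF /= subvv; split=> // a.
    exact: acts_by_scalar_subv (@is_ideal0 _ _) (subvv _).
have idF k : is_ideal (F k) by case: k => // n; apply: is_ideal0.
have F_exh : exists M : int, forall k : int, M <= k -> F k = fullv.
  by exists (Posz N) => -[] // k; exact: fN.
have F_bot : exists M : int, forall k : int, k <= M -> F k = 0%VS.
  by exists 0 => -[[|k]|k] //=.
exists {| filt_space := F; filt_increasing := fun k => (F_step k).1;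
  filt_exhaustive := F_exh; filt_bounded_below := F_bot;
  filt_metric := fun k => coord_dot_metric (subquot (F k) (F (k - 1))) |}.
split=> // k; apply: quot_act_invariant => //; exact: (F_step k).2.
Qed.
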